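(* Let $u_L:[m]\times[n]\to[-1,1]$ be a learner payoff satisfying the standing assumptions. If $\mathcal{A}$ is a consistent no-swap-regret learning algorithm (with respect to $u_L$), then its asymptotic menu satisfies $\mathcal{M}(\mathcal{A})=\mathcal{M}_{NSR}$.
   Context: The optimizer has action set $[m]$ and the learner has action set $[n]$. $\Delta_k$ is the simplex over $[k]$; $\Delta_{mn}$ is the set of probability distributions over $[m]\times[n]$, whose elements are called correlated strategy profiles (CSPs). $x\otimes y$ is the product distribution. $u_L$ is extended (multi)linearly to $\Delta_m\times\Delta_n$ and to $\Delta_{mn}$. $\mathrm{BR}_L(x)=\arg\max_{j\in[n]}u_L(x,j)$. Standing assumptions on $u_L$: (1) there is a unique pair $(i^*,j^* )\in[m]\times[n]$ maximizing $u_L$; (2) the learner has no weakly dominated action, i.e. every $j\in[n]$ for which some $x\in\Delta_m$ has $j\in\mathrm{BR}_L(x)$ also admits some $x'\in\Delta_m$ with $\mathrm{BR}_L(x')=\{j\}$. A learning algorithm $\mathcal{A}=\{A^T\}_{T\in\mathbb{N}}$ consists, for each horizon $T$, of functions $A^T_t:\Delta_m^{t-1}\to\Delta_n$, $t=1,\dots,T$; against $(x_1,\dots,x_T)\in\Delta_m^T$ the learner plays $y_t=A^T_t(x_1,\dots,x_{t-1})$. The menu $\mathcal{M}(A^T)$ is the convex hull of all points $\frac1T\sum_{t=1}^T x_t\otimes y_t$ over all optimizer sequences. $\mathcal{A}$ is consistent if $\mathcal{M}(A^1),\mathcal{M}(A^2),\dots$ converges in the Hausdorff metric; the (closed) limit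 $\mathcal{M}(\mathcal{A})$ is its asymptotic menu. $\mathcal{A}$ is no-swap-regret if there is a function $o(T)$ such that for every $T$ and every optimizer sequence, $\sum_{t=1}^T u_L(x_t,y_t)\ge\max_{\pi:[n]\to[n]}\sum_{t=1}^T u_L(x_t,\pi(y_t))-o(T)$, where $\pi$ is extended linearly to $\Delta_n$. $\mathcal{M}_{NSR}$ is the convex hull of all no-swap-regret CSPs, i.e. CSPs $\varphi$ with $\sum_{i}\varphi_{ij}u_L(i,j)\ge\max_{j'\in[n]}\sum_{i}\varphi_{ij}u_L(i,j')$ for each $j\in[n]$. *)

(* Defs.v *)
From HB Require Import structures.
From mathcomp Require Import all_boot all_order all_algebra.
From mathcomp Require Import all_classical all_reals all_analysis.

Set Implicit Arguments.
Unset Strict Implicit.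
Unset Printing Implicit Defensive.

Import Order.TTheory GRing.Theory Num.Theory.
Import numFieldNormedType.Exports.

Local Open Scope classical_set_scope.
Local Open Scope ring_scope.

Section Hausdorff.
Context {R : realType}.

Definition convex_hull {V : lmodType R} (X : set V) : set V :=
  smallest (@convex_set R V) X.

(* Extended-real valued, since it is defined on arbitrary subsets; on nonempty
   bounded subsets of a normed space it is finite. *)
Definition hausdorff_dist {T : pseudoMetricType R} (X Y : set T) : \bar R :=
  maxe (ereal_sup [set edist_inf Y x | x in X])
       (ereal_sup [set edist_inf X y | y in Y]).

End Hausdorff.

(* As a set, [simplex R k] coerces to the subtype of its elements, which is how
   it is used below; [\val] is the injection into row vectors. *)
Definition simplex (R : realType) (k : nat) : set 'rV[R]_k :=
  [set p | (forall i, 0 <= p 0 i) /\ \sum_i p 0 i = 1].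
Arguments simplex R k : clear implicits.

Section Game.
Context {R : realType} {m n : nat}.
Implicit Types (u : 'I_m -> 'I_n -> R) (x : 'rV[R]_m) (y : 'rV[R]_n).

Definition csp : set 'M[R]_(m, n) :=
  [set phi | (forall i j, 0 <= phi i j) /\ \sum_i \sum_j phi i j = 1].

Definition product_csp x y : 'M[R]_(m, n) := \matrix_(i, j) (x 0 i * y 0 j).

Definition payoff_pure u x (j : 'I_n) : R := \sum_i x 0 i * u i j.

Definition payoff u x y : R := \sum_i \sum_j x 0 i * y 0 j * u i j.

Definition best_response u x : set 'I_n :=
  [set j | forall k, payoff_pure u x k <= payoff_pure u x j].

Definition unique_maximizer u : Prop :=
  exists! p : 'I_m * 'I_n, forall i j, u i j <= u p.1 p.2.

Definition no_weakly_dominated_action u : Prop :=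
  forall j : 'I_n,
    (exists x : simplex R m, best_response u (\val x) j) ->
    exists x' : simplex R m, best_response u (\val x') = [set j].

(* [A T s] is the learner's move at horizon [T] after the optimizer has played
   the list of moves [s], i.e., in round [size s + 1]; only the values with
   [size s < T] are ever used. *)
Definition learning_algorithm : Type := nat -> seq (simplex R m) -> simplex R n.

Implicit Type A : learning_algorithm.

(* Rounds are numbered from 0, so that exactly [t] moves precede round [t]. *)
Definition opt_move (T : nat) (s : T.-tuple (simplex R m)) (t : 'I_T) : 'rV[R]_m :=
  \val (tnth s t).

Definition learner_move A (T : nat) (s : T.-tuple (simplex R m)) (t : 'I_T) :
  'rV[R]_n := \val (A T (take t s)).

Definition average_csp A (T : nat) (s : T.-tuple (simplex R m)) : 'M[R]_(m, n) :=
  T%:R^-1 *: \sum_(t < T) product_csp (opt_move s t) (learner_move A s t).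

Definition menu A (T : nat) : set 'M[R]_(m, n) :=
  convex_hull (range (@average_csp A T)).

(* Matrices carry the sup norm; as all norms on a finite-dimensional space are
   equivalent, this choice does not affect convergence. *)
Definition is_asymptotic_menu A (M : set 'M[R]_(m, n)) : Prop :=
  closed M /\ hausdorff_dist (menu A T) M @[T --> \oo] --> 0%E.

Definition consistent A : Prop := exists M, is_asymptotic_menu A M.

(* The limit is unique because it is required to be closed. The default value
   [set0] is only taken when [A] is not consistent. *)
Definition asymptotic_menu A : set 'M[R]_(m, n) :=
  xget set0 (is_asymptotic_menu A).

Definition swap (pi : 'I_n -> 'I_n) y : 'rV[R]_n :=
  \sum_j y 0 j *: delta_mx 0 (pi j).

Definition no_swap_regret u A : Prop :=
  exists2 r : nat -> R^o, r =o_\oo (fun T => T%:R : R^o) &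
    forall (T : nat) (s : T.-tuple (simplex R m)), (0 < T)%N ->
    forall pi : 'I_n -> 'I_n,
      \sum_(t < T) payoff u (opt_move s t) (learner_move A s t) >=
      \sum_(t < T) payoff u (opt_move s t) (swap pi (learner_move A s t)) - r T.

Definition nsr_csp u : set 'M[R]_(m, n) :=
  [set phi | csp phi /\
    forall j j', \sum_i phi i j * u i j >= \sum_i phi i j * u i j'].

Definition nsr_menu u : set 'M[R]_(m, n) := convex_hull (nsr_csp u).

End Game.

Arguments learning_algorithm R m n : clear implicits.

(* Main.v *)
Require Import Defs.
From mathcomp Require Import all_boot all_order all_algebra.
From mathcomp Require Import all_classical all_reals all_analysis.
From mathcomp Require Import ring.

(* The limit menu M consists of the points approached by the menus at large
   horizons, so it is closed and convex. At horizon T the menu satisfies the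
   no-swap-regret inequalities up to o(T)/T, and these pass to the limit.
   Conversely, if j is the only best response to x, an optimizer who always
   plays x forces the learner to play j most of the time, so x (x) e_j is in M.
   Having no weakly dominated action, we can perturb any x to which j is a best
   response into such a position, and M is closed, so x (x) e_j is in M there
   too. A no-swap-regret CSP is a convex combination of such points: take its
   normalized columns as the x's. *)

Set Implicit Arguments.
Unset Strict Implicit.
Unset Printing Implicit Defensive.

Import Order.TTheory GRing.Theory Num.Theory.
Import numFieldNormedType.Exports.

Local Open Scope classical_set_scope.
Local Open Scope ring_scope.

(** * Hausdorff limits of sequences of sets *)

Section HausdorffLimit.
Context {R : realType} {T : pseudoMetricType R}.
Implicit Types (X Y M K : set T) (S : nat -> set T).

Lemma edist_inf_lt X x e : (edist_inf X x < e%:E)%E ->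
  exists2 y, X y & ball x e y.
Proof.
by move=> /ereal_inf_lt[_ [y Xy <-] /edist_lt_ball xy]; exists y.
Qed.

Lemma hausdorff_dist_lt X Y e : (hausdorff_dist X Y < e%:E)%E ->
  (forall x, X x -> exists2 y, Y y & ball x e y) /\
  (forall y, Y y -> exists2 x, X x & ball y e x).
Proof.
rewrite /hausdorff_dist gt_max => /andP[XY YX]; split=> z Zz;
  apply: edist_inf_lt.
- by apply: le_lt_trans XY; apply: ereal_sup_ubound; exists z.
- by apply: le_lt_trans YX; apply: ereal_sup_ubound; exists z.
Qed.

Lemma hausdorff_cvg_near S M e : 0 < e ->
  hausdorff_dist (S k) M @[k --> \oo] --> 0%E ->
  \forall k \near \oo, (hausdorff_dist (S k) M < e%:E)%E.
Proof.
by move=> e0 /(_ _ (nbhs_open_ereal_lt (f := fun=> e) e0)).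
Qed.

(** Left to right is the second supremum in [hausdorff_dist]. Conversely, the first supremum moves a
    point of [S k] near [x] to a point of [M], each move costing [e / 2], and closedness of [M]
    concludes. *)
Lemma hausdorff_limP S M x : closed M ->
  hausdorff_dist (S k) M @[k --> \oo] --> 0%E ->
  M x <-> forall e, 0 < e -> \forall k \near \oo, exists2 y, S k y & ball x e y.
Proof.
move=> Mcl SM; split=> [Mx e e0|Sx].
  apply: filterS (hausdorff_cvg_near e0 SM) => k /hausdorff_dist_lt[_].
  exact.
apply: Mcl => B /nbhs_ballP[e /= e0 xB].
have e20 : 0 < e / 2 by rewrite divr_gt0.
have [k [[y Sky xy] /hausdorff_dist_lt[/(_ _ Sky)[z Mz yz] _]]] :
  exists k, (exists2 y, S k y & ball x (e / 2) y) /\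
            (hausdorff_dist (S k) M < (e / 2)%:E)%E.
  exact: (filter_ex (filterI (Sx _ e20) (hausdorff_cvg_near e20 SM))).
by exists z; split=> //; apply: xB; exact: ball_split xy yz.
Qed.

Lemma hausdorff_lim_sub S M K : closed M ->
  hausdorff_dist (S k) M @[k --> \oo] --> 0%E -> closed K ->
  (\forall k \near \oo, S k `<=` K) -> M `<=` K.
Proof.
move=> Mcl SM Kcl SK x /(hausdorff_limP x Mcl SM) Mx.
apply: Kcl => B /nbhs_ballP[e /= e0 xB].
have [k [[y Sy xy] Sk]] := filter_ex (filterI (Mx _ e0) SK).
by exists y; split; [exact: Sk|exact: xB].
Qed.

End HausdorffLimit.

(** * Convex combinations, convexity of limits, closed half-spaces of matrices *)

Section Convexity.
Context {R : realType} {V : lmodType R}.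
Implicit Types (X : set V).

Lemma convex_setP X : @convex_set R V X <->
  forall (a b : R) x y, 0 <= a -> 0 <= b -> a + b = 1 -> X x -> X y ->
    X (a *: x + b *: y).
Proof.
split=> [cX a b x y a0 b0 ab Xx Xy|cX x y l /set_mem Xx /set_mem Xy].
  have a1 : a <= 1 by rewrite -ab lerDl.
  have /set_mem := cX x y (Itv01 a0 a1) (mem_set Xx) (mem_set Xy).
  suff -> : b = 1 - a by [].
  by rewrite -ab addrC addKr.
apply/mem_set/cX => //; first by rewrite subr_ge0.
by rewrite addrC subrK.
Qed.

Lemma convex_sum X (I : finType) (w : I -> R) (x : I -> V) :
  @convex_set R V X -> (forall i, 0 <= w i) -> \sum_i w i = 1 ->
  (forall i, w i != 0 -> X (x i)) -> X (\sum_i w i *: x i).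
Proof.
move=> /convex_setP cX w0 w1 Xx.
(* Invariant for a partial sum [y] of total weight [a]: rescaled by its weight it lies in [X], and
   it vanishes if its weight does. *)
pose P (a : R) (y : V) :=
  0 <= a /\ (a = 0 -> y = 0) /\ (a != 0 -> X (a^-1 *: y)).
suff [_ [_]] : P (\sum_i w i) (\sum_i w i *: x i).
  by rewrite w1 oner_neq0 invr1 scale1r; apply.
elim/big_rec2: _ => [|i y a _ [a0 [ay aX]]].
  by split=> //; split=> //; rewrite eqxx.
split; first by rewrite addr_ge0.
have [wi0|wi0] := eqVneq (w i) 0; first by rewrite wi0 !add0r scale0r add0r.
have wa : w i + a != 0 by rewrite paddr_eq0// negb_and wi0.
split=> [/eqP|_]; first by rewrite (negbTE wa).
have [a00|an0] := eqVneq a 0.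
  by rewrite (ay a00) a00 !addr0 scalerA mulVf// scale1r; exact: Xx.
have -> : (w i + a)^-1 *: (w i *: x i + y) =
  (w i / (w i + a)) *: x i + (a / (w i + a)) *: (a^-1 *: y).
  by rewrite scalerDr !scalerA mulrC; congr (_ + _ *: _); field; apply/andP.
apply: cX; rewrite ?divr_ge0 ?addr_ge0//; first by rewrite -mulrDl divff.
- exact: Xx.
- exact: aX.
Qed.

End Convexity.

Lemma hausdorff_lim_convex {R : realType} {V : normedModType R}
    (S : nat -> set V) (M : set V) : closed M ->
  hausdorff_dist (S k) M @[k --> \oo] --> 0%E ->
  (forall k, @convex_set R V (S k)) -> @convex_set R V M.
Proof.
move=> Mcl SM cS; apply/convex_setP => a b x y a0 b0 ab.
move=> /(hausdorff_limP x Mcl SM) Mx /(hausdorff_limP y Mcl SM) My.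
apply/(hausdorff_limP _ Mcl SM) => e e0.
apply: filterS (filterI (Mx _ e0) (My _ e0)) => k [[x' Sx xx'] [y' Sy yy']].
exists (a *: x' + b *: y'); first exact: (convex_setP _).1.
move: xx' yy'; rewrite -!ball_normE /ball_ /= => xx' yy'.
rewrite opprD addrACA -!scalerBr (le_lt_trans (ler_normD _ _))// !normrZ.
rewrite (ger0_norm a0) (ger0_norm b0) -[ltRHS]mul1r -ab mulrDl.
(* The strict inequality is taken from the [x] term, which requires [a] to be nonzero; if [a = 0],
   it comes from the [y] term. *)
have [a00|an0] := eqVneq a 0.
  have -> : b = 1 by rewrite -ab a00 add0r.
  by rewrite a00 !mul0r !add0r !mul1r.
by rewrite ltr_leD// ?ler_wpM2l ?ltr_pM2l ?(ltW yy')// lt_neqAle eq_sym an0.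
Qed.

Lemma simplex_convex {R : realType} {k : nat} : convex_set (simplex R k).
Proof.
apply/convex_setP => a b v w a0 b0 ab [v0 v1] [w0 w1]; split=> [i|].
  by rewrite !mxE addr_ge0 ?mulr_ge0.
under eq_bigr do rewrite !mxE.
by rewrite big_split -!mulr_sumr v1 w1 !mulr1.
Qed.

Lemma simplexP {R : realType} {k : nat} (x : simplex R k) :
  simplex R k (\val x).
Proof. exact: set_mem (valP x). Qed.

Lemma closed_le_sum {R : realType} {m n : nat} (c : 'I_m -> 'I_n -> R) (a : R) :
  closed [set phi : 'M[R]_(m, n) | \sum_i \sum_j phi i j * c i j <= a].
Proof.
apply: (preimage_closed (f := fun phi : 'M[R]_(m, n) =>
  \sum_i \sum_j phi i j * c i j) (D := [set x | x <= a]));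
  last exact: closed_le.
move=> phi _; have phiF := nbhs_filter phi.
apply: cvg_big => [|i _]; first exact: add_continuous.
apply: cvg_big => [|j _]; first exact: add_continuous.
by apply: cvgMr_tmp; exact: coord_continuous.
Qed.

(** * CSPs with small swap regret *)

Section ApproxNsr.
Context {R : realType} {m n : nat}.
Implicit Types (u : 'I_m -> 'I_n -> R) (x : 'rV[R]_m) (y : 'rV[R]_n).

(** Column [j] is not normalized: this keeps the regret linear in [phi] and meaningful for a column
    without mass. *)
Definition regret u (j j' : 'I_n) (phi : 'M[R]_(m, n)) : R :=
  \sum_i phi i j * (u i j' - u i j).

(** A relaxation that contains the menus at large finite horizons. Being convex and closed, it
    passes to hulls and to Hausdorff limits. *)
Definition approx_nsr_csp u d : set 'M[R]_(m, n) :=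
  [set phi | csp phi /\ forall j j', regret u j j' phi <= d].

Lemma regret_scale_sum u j j' (I : finType) (w : I -> R)
    (phi : I -> 'M[R]_(m, n)) :
  regret u j j' (\sum_k w k *: phi k) = \sum_k w k * regret u j j' (phi k).
Proof.
rewrite /regret; under eq_bigr do rewrite summxE mulr_suml.
rewrite exchange_big /=; apply: eq_bigr => k _; rewrite mulr_sumr.
by apply: eq_bigr => i _; rewrite mxE mulrA.
Qed.

Lemma csp_convex : @convex_set R _ (@csp R m n).
Proof.
apply/convex_setP => a b x y a0 b0 ab [x0 x1] [y0 y1]; split=> [i j|].
  by rewrite !mxE addr_ge0 ?mulr_ge0.
under eq_bigr do under eq_bigr do rewrite !mxE.
under eq_bigr do rewrite big_split -!mulr_sumr.
by rewrite big_split -!mulr_sumr x1 y1 !mulr1.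
Qed.

Lemma approx_nsr_csp_convex u d : @convex_set R _ (approx_nsr_csp u d).
Proof.
apply/convex_setP => a b x y a0 b0 ab [cx rx] [cy ry]; split.
  exact: (convex_setP _).1 csp_convex _ _ _ _ _ _ _ _ _.
move=> j j'; have -> : regret u j j' (a *: x + b *: y) =
    a * regret u j j' x + b * regret u j j' y.
  rewrite /regret !mulr_sumr -big_split /=; apply: eq_bigr => i _.
  by rewrite !mxE; ring.
by rewrite -[leRHS]mul1r -ab mulrDl lerD ?ler_wpM2l.
Qed.

Lemma csp_closed : closed (@csp R m n).
Proof.
(* The equation for the total mass becomes two inequalities, with weights 1 and -1, to fit
   [closed_le_sum]. *)
have -> : @csp R m n =
    (\bigcap_(p in setT) [set phi : 'M[R]_(m, n) | 0 <= phi p.1 p.2]) `&`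
    ([set phi | \sum_i \sum_j phi i j * 1 <= 1] `&`
     [set phi | \sum_i \sum_j phi i j * -1 <= -1]).
  have sumE (phi : 'M[R]_(m, n)) (c : R) :
      \sum_i \sum_j phi i j * c = (\sum_i \sum_j phi i j) * c.
    by rewrite mulr_suml; apply: eq_bigr => i _; rewrite mulr_suml.
  apply/seteqP; split=> phi /=; rewrite !sumE mulr1 mulrN1 lerN2.
    by move=> [p0 ->]; split=> [[i j] _|]; [exact: p0|rewrite lexx].
  move=> [p0 [le1 ge1]]; split=> [i j|]; first exact: (p0 (i, j)).
  by apply/eqP; rewrite eq_le le1.
apply: closedI; last by apply: closedI; exact: closed_le_sum.
apply: closed_bigI => p _.
apply: (preimage_closed (f := fun phi : 'M[R]_(m, n) => phi p.1 p.2)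
  (D := [set x | 0 <= x])); last exact: closed_ge.
by move=> phi _; exact: coord_continuous.
Qed.

Lemma approx_nsr_csp_closed u d : closed (approx_nsr_csp u d).
Proof.
have -> : approx_nsr_csp u d = @csp R m n `&` \bigcap_(p in setT)
    [set phi | \sum_i \sum_j phi i j *
      (if j == p.1 then u i p.2 - u i p.1 else 0) <= d].
  have sumE j j' (phi : 'M[R]_(m, n)) : \sum_i \sum_k phi i k *
      (if k == j then u i j' - u i j else 0) = regret u j j' phi.
    apply: eq_bigr => i _; rewrite (bigD1 j)//= eqxx big1 ?addr0// => k kj.
    by rewrite (negbTE kj) mulr0.
  apply/seteqP; split=> phi [cphi rphi]; split=> //.
    by move=> [j j'] _ /=; rewrite sumE.
  by move=> j j'; rewrite -sumE; exact: (rphi (j, j')).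
apply: closedI; first exact: csp_closed.
by apply: closed_bigI => p _; exact: closed_le_sum.
Qed.

Lemma approx_nsr_csp0 u : approx_nsr_csp u 0 = nsr_csp u.
Proof.
have rE j j' (phi : 'M[R]_(m, n)) : (regret u j j' phi <= 0) =
    (\sum_i phi i j * u i j >= \sum_i phi i j * u i j').
  by rewrite /regret; under eq_bigr do rewrite mulrBr; rewrite sumrB subr_le0.
by apply/seteqP; split=> phi [cphi rphi]; split=> // j j';
  [rewrite -rE|rewrite rE].
Qed.

Lemma nsr_menuE u : nsr_menu u = nsr_csp u.
Proof.
by apply: smallest_id; rewrite -approx_nsr_csp0; exact: approx_nsr_csp_convex.
Qed.

Lemma product_cspP x y : simplex R m x -> simplex R n y ->
  csp (product_csp x y).
Proof.
move=> [x0 x1] [y0 y1]; split=> [i j|]; first by rewrite mxE mulr_ge0.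
under eq_bigr do under eq_bigr do rewrite mxE.
by under eq_bigr do rewrite -mulr_sumr y1 mulr1.
Qed.

Lemma regret_product u j j' x y : regret u j j' (product_csp x y) =
  y 0 j * (payoff_pure u x j' - payoff_pure u x j).
Proof.
rewrite /payoff_pure -sumrB mulr_sumr; apply: eq_bigr => i _.
by rewrite mxE; ring.
Qed.

Lemma payoffE u x y : payoff u x y = \sum_j y 0 j * payoff_pure u x j.
Proof.
rewrite /payoff exchange_big /=; apply: eq_bigr => j _; rewrite mulr_sumr.
by apply: eq_bigr => i _; ring.
Qed.

Lemma payoff_swap u x y pi :
  payoff u x (swap pi y) = \sum_j y 0 j * payoff_pure u x (pi j).
Proof.
rewrite payoffE /swap; under eq_bigr do rewrite summxE mulr_suml.
rewrite exchange_big /=; apply: eq_bigr => j _.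
rewrite (bigD1 (pi j))//= !mxE !eqxx mulr1 big1 ?addr0// => k kj.
by rewrite !mxE (negbTE kj) mulr0 mul0r.
Qed.

(** Swaps that move a single action turn the bound over all [pi] into one linear inequality per pair
    of actions. *)
Lemma payoff_swap_one u x y j j' :
  payoff u x (swap (fun k => if k == j then j' else k) y) - payoff u x y =
  regret u j j' (product_csp x y).
Proof.
rewrite payoff_swap payoffE -sumrB regret_product (bigD1 j)//= eqxx.
rewrite big1 ?addr0 ?mulrBr// => k kj.
by rewrite (negbTE kj) subrr.
Qed.

End ApproxNsr.

(** * Menus at a finite horizon *)

Section Menus.
Context {R : realType} {m n : nat}.
Variables (u : 'I_m -> 'I_n -> R) (A : learning_algorithm R m n).

Lemma average_cspE T (s : T.-tuple (simplex R m)) : average_csp A s =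
  \sum_(t < T) T%:R^-1 *: product_csp (opt_move s t) (learner_move A s t).
Proof. by rewrite /average_csp scaler_sumr. Qed.

Lemma sum_inv_nat T : (0 < T)%N -> \sum_(t < T) T%:R^-1 = 1 :> R.
Proof.
move=> T0; rewrite sumr_const card_ord.
by rewrite -(mulr_natl T%:R^-1) divff// pnatr_eq0 -lt0n.
Qed.

Lemma average_csp_approx_nsr T (s : T.-tuple (simplex R m)) (r : R) :
  (0 < T)%N ->
  (forall pi : 'I_n -> 'I_n,
    \sum_(t < T) payoff u (opt_move s t) (learner_move A s t) >=
    \sum_(t < T) payoff u (opt_move s t) (swap pi (learner_move A s t)) - r) ->
  approx_nsr_csp u (r / T%:R) (average_csp A s).
Proof.
move=> T0 Ar; rewrite average_cspE; split=> [|j j'].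
  apply: convex_sum; [exact: csp_convex|by []|exact: sum_inv_nat|].
  by move=> t _; apply: product_cspP; exact: simplexP.
rewrite regret_scale_sum -mulr_sumr mulrC ler_wpM2r ?invr_ge0//.
under eq_bigr do rewrite -payoff_swap_one.
by rewrite sumrB lerBlDr addrC -lerBlDr.
Qed.

(** The product is linear in its second factor, so against constant play the average CSP is again a
    product, [y] being the mean of the learner's moves. *)
Lemma constant_play_menu T (x : simplex R m) : (0 < T)%N ->
  exists2 y, simplex R n y & menu A T (product_csp (\val x) y).
Proof.
move=> T0; pose s := [tuple of nseq T x].
exists (\sum_(t < T) T%:R^-1 *: learner_move A s t).
  apply: convex_sum => //; [exact: simplex_convex|exact: sum_inv_nat|].
  by move=> t _; exact: simplexP.
apply: sub_gen_smallest; exists s => //; rewrite average_cspE.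
apply/matrixP => i j; rewrite mxE !summxE mulr_sumr; apply: eq_bigr => t _.
by rewrite !mxE /opt_move tnth_nseq; ring.
Qed.

End Menus.

Lemma menu_near_approx_nsr {R : realType} {m n : nat} (u : 'I_m -> 'I_n -> R)
    (A : learning_algorithm R m n) d : no_swap_regret u A -> 0 < d ->
  \forall T \near \oo, (0 < T)%N /\ menu A T `<=` approx_nsr_csp u d.
Proof.
(* Little-o at the constant [d] says that [r T / T] is eventually at most [d]. *)
move=> [r /eqoP/(_ d) ro Ar] d0.
apply: filterS (filterI (ro d0) (nbhs_infty_gt 0)) => T [rd T0]; split=> //.
apply: smallest_sub; first exact: approx_nsr_csp_convex.
move=> _ [s _ <-].
have [cs rs] := average_csp_approx_nsr T0 (Ar T s T0).
split=> // j j'; apply: le_trans (rs j j') _.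
rewrite ler_pdivrMr ?ltr0n//; apply: le_trans (ler_norm _) _.
by move: rd; rewrite normr_nat.
Qed.

(** In the sup norm, each entry differs by at most the mass that [y] puts off [j], since the entries
    of [x] are at most 1. *)
Lemma product_csp_ball {R : realType} {m n : nat} (x : 'rV[R]_m) (y : 'rV[R]_n)
    (j : 'I_n) e : simplex R m x -> simplex R n y ->
  \sum_(k < n | k != j) y 0 k < e ->
  ball (product_csp x (delta_mx 0 j)) e (product_csp x y).
Proof.
move=> [x0 x1] [y0 y1] ye.
have e0 : 0 < e by apply: le_lt_trans ye; exact: sumr_ge0.
have x_le1 i : x 0 i <= 1.
  by rewrite -x1 (bigD1 i)//= lerDl sumr_ge0.
split=> // i k; rewrite -ball_normE /ball_ /= !mxE -mulrBr normrM.
rewrite (ger0_norm (x0 i)); apply: le_lt_trans ye.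
apply: le_trans (ler_piMl (normr_ge0 _) (x_le1 i)) _.
have [->|kj] := eqVneq k j.
  by rewrite eqxx -y1 (bigD1 j)//= [y 0 j + _]addrC addrK ger0_norm// sumr_ge0.
by rewrite eqxx sub0r normrN ger0_norm// (bigD1 k)//= lerDl sumr_ge0.
Qed.

Lemma strict_best_response_lt {R : realType} {m n : nat}
    (u : 'I_m -> 'I_n -> R) (x : 'rV[R]_m) j k :
  best_response u x = [set j] -> k != j ->
  payoff_pure u x k < payoff_pure u x j.
Proof.
move=> xj; have Jj : best_response u x j by rewrite xj.
apply: contraNlt => jk; apply/eqP.
suff : best_response u x k by rewrite xj.
by move=> l; apply: le_trans (Jj l) jk.
Qed.

(** * The two inclusions for the limit menu *)

Section Limit.
Context {R : realType} {m n : nat}.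
Variables (u : 'I_m -> 'I_n -> R) (A : learning_algorithm R m n).
Variable M : set 'M[R]_(m, n).
Hypotheses (A_nsr : no_swap_regret u A) (AM : is_asymptotic_menu A M).

Lemma asymptotic_menu_convex : @convex_set R _ M.
Proof.
case: AM => Mcl AMM; apply: (hausdorff_lim_convex Mcl AMM) => T.
by move=> x y l xX yX; apply/mem_set => X [cX sX]; apply/set_mem/cX;
  apply/mem_set; [move: xX|move: yX] => /set_mem; apply.
Qed.

Lemma asymptotic_menu_sub_nsr : M `<=` nsr_csp u.
Proof.
case: AM => Mcl AMM.
have Md d : 0 < d -> M `<=` approx_nsr_csp u d.
  move=> d0; apply: (hausdorff_lim_sub Mcl AMM).
    exact: approx_nsr_csp_closed.
  by apply: filterS (menu_near_approx_nsr A_nsr d0) => T [].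
rewrite -approx_nsr_csp0 => phi Mphi; split.
  by have [] := Md 1 ltr01 _ Mphi.
move=> j j'; apply/ler_addgt0Pr => d d0; rewrite add0r.
by have [_] := Md d d0 _ Mphi.
Qed.

Lemma strict_best_response_asymptotic_menu x j : simplex R m x ->
  best_response u x = [set j] -> M (product_csp x (delta_mx 0 j)).
Proof.
move=> sx xj; case: AM => Mcl AMM; apply/(hausdorff_limP _ Mcl AMM) => e e0.
(* Mass on [k] costs regret [g k] per unit against [j], so slack [d] allows at most [d / g k] of it,
   hence [d * C] off [j] in total. *)
pose g k := payoff_pure u x j - payoff_pure u x k.
have g0 k : k != j -> 0 < g k.
  by move=> kj; rewrite subr_gt0; exact: strict_best_response_lt.
pose C := \sum_(k < n | k != j) (g k)^-1.
have C0 : 0 < C + 1.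
  by rewrite ltr_wpDl// sumr_ge0// => k /g0/ltW; rewrite invr_ge0.
(* Chosen so that [d * C < e]; adding 1 makes this strict and covers [C = 0], when [j] is the only
   action. *)
pose d := e / (C + 1); have d0 : 0 < d by rewrite divr_gt0.
apply: filterS (menu_near_approx_nsr A_nsr d0) => T [T0 Ad].
have [y sy Ay] := constant_play_menu A (exist _ x (mem_set sx)) T0.
exists (product_csp x y) => //; apply: product_csp_ball => //.
have [_ ry] := Ad _ Ay.
apply: (@le_lt_trans _ _ (d * C)); last first.
  by rewrite /d mulrAC ltr_pdivrMr// ltr_pM2l// ltrDl.
rewrite mulr_sumr; apply: ler_sum => k kj.
rewrite ler_pdivlMr ?g0//.
by have := ry k j; rewrite regret_product.
Qed.

Lemma best_response_asymptotic_menu x j : no_weakly_dominated_action u ->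
  simplex R m x -> best_response u x j -> M (product_csp x (delta_mx 0 j)).
Proof.
move=> u_undom sx xj.
have [x' x'j] := u_undom j (ex_intro _ (exist _ x (mem_set sx)) xj).
pose z := \val x'; have sz : simplex R m z := simplexP x'.
(* Moving from [x] towards [z], the product is affine in [t], so it tends to the desired point as
   [t] decreases to 0. *)
pose v t := product_csp (x + t *: (z - x)) (delta_mx 0 j : 'rV[R]_n).
have vE : v = fun t => product_csp x (delta_mx 0 j) +
    t *: product_csp (z - x) (delta_mx 0 j).
  by apply/funext => t; apply/matrixP => i k; rewrite !mxE; ring.
have v0 : v 0 = product_csp x (delta_mx 0 j) by rewrite vE scale0r addr0.
have v_cvg : v t @[t --> 0] --> v 0.
  rewrite vE; apply: cvgD; first exact: cvg_cst.
  by apply: cvgZr_tmp; exact: cvg_id.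
case: AM => Mcl _.
apply: (@closed_cvg _ _ (at_right (0 : R)) _ v M Mcl); last first.
  by rewrite -v0; exact: cvg_at_right_filter.
near=> t.
have t0 : 0 < t by [].
have t1 : t <= 1 by near: t; exact: nbhs_right_le.
have pE k : payoff_pure u (x + t *: (z - x)) k =
    (1 - t) * payoff_pure u x k + t * payoff_pure u z k.
  rewrite /payoff_pure !mulr_sumr -big_split /=; apply: eq_bigr => i _.
  by rewrite !mxE; ring.
apply: strict_best_response_asymptotic_menu.
  have -> : x + t *: (z - x) = (1 - t) *: x + t *: z.
    by apply/rowP => i; rewrite !mxE; ring.
  apply: ((convex_setP _).1 simplex_convex) => //; last by rewrite subrK.
  by rewrite subr_ge0.
(* The weak inequality at [x] and the strict one at [z], with weights [1 - t] and [t > 0], add up to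
   a strict one. *)
have tlt k : k != j -> payoff_pure u (x + t *: (z - x)) k <
    payoff_pure u (x + t *: (z - x)) j.
  move=> kj; rewrite !pE ler_ltD ?ltr_pM2l ?(strict_best_response_lt x'j)//.
  by rewrite ler_wpM2l ?subr_ge0.
apply/seteqP; split=> k /=.
  by move=> kbr; apply/eqP; apply: contraT => /tlt; rewrite ltNge kbr.
move=> -> l; have [->//|lj] := eqVneq l j.
exact/ltW/tlt.
Unshelve. all: by end_near. Qed.

Lemma nsr_sub_asymptotic_menu : no_weakly_dominated_action u ->
  nsr_csp u `<=` M.
Proof.
move=> u_undom phi [[phi0 phi1] phiBR].
pose p j := \sum_i phi i j.
(* If [p j = 0], the inverse is 0 and [x j] is the zero row, outside the simplex; [convex_sum] asks
   for membership only at nonzero weights. *)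
pose x j : 'rV[R]_m := \row_i ((p j)^-1 * phi i j).
have p0 j : 0 <= p j by exact: sumr_ge0.
have -> : phi = \sum_j p j *: product_csp (x j) (delta_mx 0 j).
  apply/matrixP => i k; rewrite summxE (bigD1 k)//= big1 ?addr0; last first.
    by move=> j jk; rewrite !mxE eq_sym (negbTE jk) !mulr0.
  rewrite !mxE !eqxx mulr1; have [pk0|pk0] := eqVneq (p k) 0.
    rewrite pk0 mul0r; apply/eqP; move/eqP: pk0; rewrite psumr_eq0//.
    by move=> /allP/(_ i); rewrite mem_index_enum => /(_ isT).
  by rewrite mulVKf.
apply: convex_sum asymptotic_menu_convex _ _ _ => //.
  by rewrite -phi1 exchange_big.
move=> j pj0; apply: best_response_asymptotic_menu => //.
  split=> [i|]; first by rewrite mxE mulr_ge0 ?invr_ge0.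
  under eq_bigr do rewrite mxE.
  by rewrite -mulr_sumr mulVf.
(* Divided by [p j], the no-swap-regret inequality of column [j] says that [j] is a best response to
   [x j]. *)
move=> k; rewrite /payoff_pure.
have xE l : \sum_i x j 0 i * u i l = (p j)^-1 * \sum_i phi i j * u i l.
  by rewrite mulr_sumr; apply: eq_bigr => i _; rewrite mxE mulrA.
by rewrite !xE ler_wpM2l ?invr_ge0.
Qed.

End Limit.

Theorem theorem3p9 (R : realType) (m n : nat) (u : 'I_m -> 'I_n -> R)
    (u_bounded : forall i j, -1 <= u i j <= 1)
    (u_max : unique_maximizer u)
    (u_undominated : no_weakly_dominated_action u)
    (A : learning_algorithm R m n)
    (A_consistent : consistent A)
    (A_nsr : no_swap_regret u A) :
  asymptotic_menu A = nsr_menu u.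
Proof.
(* Consistency rules out the default [set0], so the asymptotic menu is a genuine limit. *)
have AM := xgetPex set0 A_consistent; rewrite nsr_menuE; apply/seteqP; split.
  exact: asymptotic_menu_sub_nsr A_nsr AM.
exact: nsr_sub_asymptotic_menu A_nsr AM u_undominated.
Qed.
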